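(* Let $\Gamma$ be a finitely generated subgroup of $\mathrm{Homeo}_+(I)$, the group of orientation preserving homeomorphisms of $I=[0,1]$. Assume that for all $N\in\mathbb{N}$, for every sequence $0<x_1<x_2<\dots<x_N<1$, and for all $\epsilon>0$, there exists an element $\gamma\in\Gamma$ such that $\mathrm{Fix}(\gamma)=\{0,c_1,\dots,c_N,1\}$ and $|c_i-x_i|<\epsilon$ for all $1\le i\le N$. Then $\mathrm{girth}(\Gamma)=\infty$.
   Context: $\mathrm{Fix}(\gamma)=\{x\in[0,1] : \gamma(x)=x\}$. For a finitely generated group $\Gamma$ and a finite generating set $S$ of $\Gamma$, $\mathrm{girth}(\Gamma,S)$ is the minimal length of a relation among the elements of $S$, i.e. the minimal length of a non-trivial reduced word in the free group formally generated by the elements of $S$ which represents the identity of $\Gamma$ ($\infty$ if there is no such word). Then $\mathrm{girth}(\Gamma)=\sup \mathrm{girth}(\Gamma,S)$, where the supremum is over all finite generating sets $S$ of $\Gamma$. *)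

(* Defs.v *)
From HB Require Import structures.
From mathcomp Require Import all_boot all_order all_algebra.
From mathcomp Require Import all_classical all_reals all_analysis.

Set Implicit Arguments.
Unset Strict Implicit.
Unset Printing Implicit Defensive.

Import Order.TTheory GRing.Theory Num.Theory.
Import numFieldNormedType.Exports.

Local Open Scope classical_set_scope.
Local Open Scope ring_scope.

                                                                             
                                
Definition unit_itv (R : realType) : set R := `[0, 1]%classic.
Arguments unit_itv : clear implicits.

                                                               
Record homeo (R : realType) := Homeo {
  homeo_fun :> unit_itv R -> unit_itv R;
  homeo_inv : unit_itv R -> unit_itv R;
  homeo_funK : cancel homeo_fun homeo_inv;
  homeo_invK : cancel homeo_inv homeo_fun;
  homeo_cts : continuous homeo_fun;
  homeo_inv_cts : continuous homeo_inv;
  homeo_incr : {homo homeo_fun : x y / \val x < \val y}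
}.

Lemma homeo_eq (R : realType) (f g : homeo R) : f =1 g -> f = g.
Proof.
case: f g => [f f' fK f'K fc f'c fi] [g g' gK g'K gc g'c gi] /= fg.
have {}fg : f = g by apply/funext.
subst g; have f'g' : f' = g' by apply/funext => x; rewrite -{1}(g'K x) fK.
by subst g'; congr Homeo; exact: Prop_irrelevance.
Qed.

Section homeo_group.
Variable R : realType.

Lemma homeo_inv_incr (f : homeo R) :
  {homo homeo_inv f : x y / \val x < \val y}.
Proof.
move=> x y xy; rewrite ltNge le_eqVlt; apply/negP => /orP[/eqP/val_inj e|].
  by move: xy; rewrite -(homeo_invK f x) -(homeo_invK f y) e ltxx.
by move=> /(@homeo_incr _ f); rewrite !homeo_invK => /(lt_trans xy); rewrite ltxx.
Qed.

Definition homeo_id : homeo R :=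
  @Homeo R id id (fun=> erefl) (fun=> erefl)
    (fun=> cvg_id) (fun=> cvg_id) (fun _ _ xy => xy).

Definition homeo_opp (f : homeo R) : homeo R :=
  Homeo (homeo_invK f) (homeo_funK f) (@homeo_inv_cts _ f) (@homeo_cts _ f)
    (@homeo_inv_incr f).

Definition homeo_comp (f g : homeo R) : homeo R :=
  @Homeo R (f \o g) (homeo_inv g \o homeo_inv f)
    (can_comp (homeo_funK f) (homeo_funK g))
    (can_comp (homeo_invK g) (homeo_invK f))
    (fun x => continuous_comp (@homeo_cts _ g x) (@homeo_cts _ f (g x)))
    (fun x => continuous_comp (@homeo_inv_cts _ f x)
                (@homeo_inv_cts _ g (homeo_inv f x)))
    (fun _ _ xy => homeo_incr f (homeo_incr g xy)).

Lemma homeo_compA : associative homeo_comp.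
Proof. by move=> f g h; apply: homeo_eq. Qed.

Lemma homeo_comp1f : left_id homeo_id homeo_comp.
Proof. by move=> f; apply: homeo_eq. Qed.

Lemma homeo_compf1 : right_id homeo_id homeo_comp.
Proof. by move=> f; apply: homeo_eq. Qed.

Lemma homeo_compVf : left_inverse homeo_id homeo_opp homeo_comp.
Proof. by move=> f; apply: homeo_eq => x /=; rewrite homeo_funK. Qed.

Lemma homeo_compfV : right_inverse homeo_id homeo_opp homeo_comp.
Proof. by move=> f; apply: homeo_eq => x /=; rewrite homeo_invK. Qed.

HB.instance Definition _ := gen_eqMixin (homeo R).
HB.instance Definition _ := gen_choiceMixin (homeo R).
HB.instance Definition _ := isGroup.Build (homeo R)
  homeo_compA homeo_comp1f homeo_compf1 homeo_compVf homeo_compfV.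

End homeo_group.

Definition Fix (R : realType) (f : homeo R) : set R :=
  [set \val x | x in [set x : unit_itv R | f x = x]].

Section girth.
Variable G : groupType.
Implicit Types (S H : set G) (w : seq (G * bool)).

Definition is_subgroup H : Prop := group_closed [in H].

                                                                        
Definition finite_generating_set H S : Prop :=
  finite_set S /\ smallest is_subgroup S = H.

Definition finitely_generated H : Prop := exists S, finite_generating_set H S.

                                                                              
Definition word_over S w : Prop := forall a, a \in w -> S a.1.

Definition reduced w : bool :=
  sorted [rel a b : G * bool | ~~ ((a.1 == b.1) && (a.2 != b.2))] w.

Definition word_value w : G :=
  (\prod_(a <- w) (if a.2 then a.1^-1 else a.1))%g.

Definition relation_among S w : Prop :=
  [/\ word_over S w, reduced w, w != [::] & word_value w = 1%g].

End girth.

                                                                           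
          
Definition girth_wrt (R : realType) (G : groupType) (S : set G) : \bar R :=
  ereal_inf [set ((size w)%:R)%:E | w in [set w | relation_among S w]].
Arguments girth_wrt R {G} S.

Definition girth (R : realType) (G : groupType) (H : set G) : \bar R :=
  ereal_sup [set girth_wrt R S | S in [set S | finite_generating_set H S]].
Arguments girth R {G} H.

(* Main.v *)
(* The key point is that Gamma is dense in Homeo_+(I) for pointwise
   convergence: an element whose fixed points separate given marked points,
   except that none lies in [z, q], has a power that pushes z above q without
   changing the relevant order relations between the images and the marks.

   Let g_1, ..., g_n generate Gamma, fix m, and let a, b be elements of Gamma.
   With h_i = a^(N_i) b g_i b a^(N_i), the set {a, b, h_1, ..., h_n} generates
   Gamma, and if the N_i exceed m and are more than m apart, then a reduced word
   of length at most m in these generators expands to a word in a, b and the g_i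
   in which the letters a, b stay reduced even after the g_i are deleted.  For
   such a word the orbit of a point can be followed while imposing on a and b
   finitely many strict inequalities a(p) < q or a(p) > q, whether or not the
   g_i move the point, so that the point ends elsewhere.  By density some a, b
   in Gamma satisfy these inequalities for all words of length at most m. *)

Require Import Defs.
From HB Require Import structures.
From mathcomp Require Import all_boot all_order all_algebra.
From mathcomp Require Import all_classical all_reals all_analysis.
From mathcomp Require Import zify lra.

Set Implicit Arguments.
Unset Strict Implicit.
Unset Printing Implicit Defensive.

Import Order.TTheory GRing.Theory Num.Theory.
Import numFieldNormedType.Exports.

Local Open Scope classical_set_scope.
Local Open Scope ring_scope.

(** * Homeomorphisms of the interval as order automorphisms of the line *)

Section extension.
Variable R : realType.
Implicit Types (f g : homeo R) (x y : R).

(** Extending by the identity outside [0, 1] lets products be evaluated at plain reals, without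
    membership proofs. *)
Definition ext f x : R := oapp (fun y : unit_itv R => \val (f y)) x (insub x).

Lemma mem_unit_itv x : (x \in unit_itv R) = (0 <= x <= 1).
Proof. by rewrite /unit_itv mem_setE in_itv. Qed.

Lemma unit_itv_ind (P : R -> Prop) :
  (forall y : unit_itv R, P (\val y)) -> forall x, 0 <= x <= 1 -> P x.
Proof. by move=> Py x; rewrite -mem_unit_itv => xU; exact: (Py (exist _ x xU)). Qed.

Lemma ext_val f (y : unit_itv R) : ext f (\val y) = \val (f y).
Proof. by rewrite /ext valK. Qed.

Lemma ext_out f x : ~~ (0 <= x <= 1) -> ext f x = x.
Proof. by move=> xI; rewrite /ext insubN // mem_unit_itv. Qed.

Lemma ext_itv f x : (0 <= ext f x <= 1) = (0 <= x <= 1).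
Proof.
have [xI|xI] := boolP (0 <= x <= 1); last by rewrite ext_out // (negbTE xI).
by elim/unit_itv_ind: x / xI => y; rewrite ext_val -mem_unit_itv; exact: valP.
Qed.

Lemma ext1 x : ext 1%g x = x.
Proof. by rewrite /ext; case: insubP => //= y _ <-. Qed.

Lemma extM f g x : ext (f * g)%g x = ext f (ext g x).
Proof.
have [xI|xI] := boolP (0 <= x <= 1); last by rewrite !ext_out.
by elim/unit_itv_ind: x / xI => y; rewrite !ext_val.
Qed.

Lemma extK f : cancel (ext f) (ext f^-1%g).
Proof. by move=> x; rewrite -extM mulVg ext1. Qed.

Lemma extVK f : cancel (ext f^-1%g) (ext f).
Proof. by move=> x; rewrite -extM mulgV ext1. Qed.

Lemma ext_lt f : {mono ext f : x y / x < y}.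
Proof.
apply: leW_mono; apply: le_mono => x y xy.
have [xI|xI] := boolP (0 <= x <= 1); have [yI|yI] := boolP (0 <= y <= 1).
- elim/unit_itv_ind: x / xI xy => x; elim/unit_itv_ind: y / yI => y.
  by rewrite !ext_val; apply: homeo_incr.
(* When exactly one of the two points lies in [0, 1], it stays there and the other is fixed. *)
- have := xI; rewrite -(ext_itv f) (ext_out f yI); lra.
- have := yI; rewrite -(ext_itv f) (ext_out f xI); lra.
- by rewrite !ext_out.
Qed.

Lemma ext_le f : {mono ext f : x y / x <= y}.
Proof. by move=> x y; rewrite !leNgt ext_lt. Qed.

Lemma ltr_extV f x y : (x < ext f^-1%g y) = (ext f x < y).
Proof. by rewrite -[in RHS](extVK f y) ext_lt. Qed.

Lemma ltl_extV f x y : (ext f^-1%g x < y) = (x < ext f y).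
Proof. by rewrite -[in RHS](extVK f x) ext_lt. Qed.

Lemma ext_at0 f : ext f 0 = 0.
Proof.
have := ext_itv f^-1%g 0; have := ext_itv f 0; rewrite lexx ler01 /=.
move=> /andP[f0 _] /andP[fV0 _]; apply/eqP; rewrite eq_le f0 andbT.
by rewrite -(ext_le f) extVK in fV0.
Qed.

Lemma ext_at1 f : ext f 1 = 1.
Proof.
have := ext_itv f^-1%g 1; have := ext_itv f 1; rewrite lexx ler01 /=.
move=> /andP[_ f1] /andP[_ fV1]; apply/eqP; rewrite eq_le f1 /=.
by rewrite -(ext_le f) extVK in fV1.
Qed.

Lemma ext_oo f x : (0 < ext f x < 1) = (0 < x < 1).
Proof. by rewrite -{1}(ext_at0 f) -{1}(ext_at1 f) !ext_lt. Qed.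

Lemma FixE f x : Fix f x <-> 0 <= x <= 1 /\ ext f x = x.
Proof.
split=> [[y fy <-]|[xI]].
  by rewrite ext_val fy -mem_unit_itv; split; [exact: valP|].
elim/unit_itv_ind: x / xI => y; rewrite ext_val => fy.
by exists y => //; apply: val_inj.
Qed.

(* The supremum of the orbit of [x] would be a fixed point in [x, y]. *)
Lemma fixfree_orbit_gt f x y : x < ext f x ->
  (forall z, x <= z <= y -> ext f z <> z) -> exists n, y < ext (f ^+ n)%g x.
Proof.
move=> xfx nofix; apply: contrapT => /forallNP bounded.
pose A := [set ext (f ^+ n)%g x | n in setT].
have ubA : ubound A y by move=> _ [n _ <-]; rewrite leNgt; apply/negP.
have supA : has_sup A by split; [exists x; exists 0%N; rewrite // expg0 ext1|exists y].
have Ax n : ext (f ^+ n)%g x <= sup A by apply: ub_le_sup; [exists y|exists n].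
apply: (nofix (sup A)).
  apply/andP; split.
    by rewrite -[leLHS]ext1 -(expg0 f); exact: Ax.
  by apply: ge_sup => //; exact: supA.1.
apply/eqP; rewrite eq_le; apply/andP; split.
  rewrite leNgt; apply/negP; rewrite -ltl_extV => /(sup_gt supA.1)[_ [n _ <-]].
  by rewrite ltl_extV => ltA; have := Ax n.+1; rewrite leNgt expgS extM ltA.
apply: ge_sup; first exact: supA.1.
move=> _ [[|n] _ <-]; last by rewrite expgS extM ext_le; exact: Ax.
by rewrite expg0 ext1 (le_trans (ltW xfx)) // ext_le -[leLHS]ext1 -(expg0 f); exact: Ax.
Qed.

End extension.

(** * The fixed point hypothesis and closure properties of subgroups *)

Definition prescribed_fixpoints (R : realType) (Gamma : set (homeo R)) : Prop :=
  forall (N : nat) (x : 'I_N -> R) (eps : R),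
     (0 < N)%N ->
     (forall i : 'I_N, 0 < x i < 1) ->
     (forall i j : 'I_N, (i < j)%N -> x i < x j) ->
     0 < eps ->
     exists2 gamma : homeo R, Gamma gamma &
       exists2 c : 'I_N -> R,
         Fix gamma = [set 0; 1] `|` range c &
         forall i : 'I_N, `|c i - x i| < eps.

Section subgroups.
Variables (G : groupType) (H : set G).
Hypothesis H_subgroup : is_subgroup H.

Lemma subgroup1 : H 1%g.
Proof. by case: H_subgroup; rewrite inE. Qed.

Lemma subgroupV x : H x -> H x^-1%g.
Proof. by move=> Hx; have := group_closedV H_subgroup (x := x); rewrite !inE; exact. Qed.

Lemma subgroupM x y : H x -> H y -> H (x * y)%g.
Proof.
by move=> Hx Hy; have := group_closedM H_subgroup (x := x) (y := y); rewrite !inE; exact.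
Qed.

Lemma subgroupX x n : H x -> H (x ^+ n)%g.
Proof.
move=> Hx; elim: n => [|n IHn]; first by rewrite expg0; exact: subgroup1.
by rewrite expgS; exact: subgroupM.
Qed.

End subgroups.

Lemma pos_lower_bound (R : realType) (s : seq R) :
  {in s, forall x, 0 < x} -> exists2 e, 0 < e & {in s, forall x, e <= x}.
Proof.
elim: s => [|x s IHs] s_gt0; first by exists 1.
have [|e e_gt0 le_e] := IHs; first by move=> y ys; rewrite s_gt0 // inE ys orbT.
exists (Num.min x e); first by rewrite lt_min e_gt0 s_gt0 // mem_head.
move=> y; rewrite inE => /predU1P[->|/le_e ey]; first by rewrite ge_min lexx.
by rewrite ge_min ey orbT.
Qed.

(** * Density of [Gamma] for pointwise convergence *)

Section density.
Variables (R : realType) (Gamma : set (homeo R)).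
Hypothesis Gamma_subgroup : is_subgroup Gamma.
Hypothesis Gamma_fix : prescribed_fixpoints Gamma.

(** Fixed points are prescribed at the midpoints of the windows, with an error below half of every
    width. Windows may overlap or share a midpoint, hence [undup]. *)
Lemma fix_windows (P : seq (R * R)) : P != [::] ->
    {in P, forall p, [/\ 0 < p.1, p.1 < p.2 & p.2 <= 1]} ->
  exists2 f, Gamma f &
    {in P, forall p, exists2 t, p.1 < t < p.2 & ext f t = t} /\
    (forall t, 0 < t < 1 -> ext f t = t -> exists2 p, p \in P & p.1 < t < p.2).
Proof.
move=> P0 PI; pose mid (p : R * R) := (p.1 + p.2) / 2.
pose xs := sort <=%R (undup (map mid P)).
have xsP t : reflect (exists2 p, p \in P & t = mid p) (t \in xs).
  by rewrite mem_sort mem_undup; apply: mapP.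
have [|e e_gt0 le_e] := @pos_lower_bound R [seq (p.2 - p.1) / 2 | p <- P].
  by move=> _ /mapP[p /PI[_ ? _] ->]; lra.
have {}le_e p : p \in P -> e <= (p.2 - p.1) / 2 by move=> pP; apply: le_e; apply: map_f.
have win p t : p \in P -> `|t - mid p| < e -> p.1 < t < p.2.
  by move=> /le_e + te; move: te; rewrite ltr_norml /mid; lra.
have xs_gt0 : (0 < size xs)%N.
  case: P P0 @xs xsP {PI le_e win} => // p P _ xs xsP.
  by apply: leq_ltn_trans (leq0n _) (_ : (index (mid p) xs < _)%N);
    rewrite index_mem; apply/xsP; exists p; rewrite ?mem_head.
have [|||f Gf [c Fixf cx]] := @Gamma_fix _ (fun i : 'I_(size xs) => nth 0 xs i) e xs_gt0.
- by move=> i; have /xsP[p /PI[? ? ?] ->] := mem_nth 0 (ltn_ord i); rewrite /mid; lra.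
- move=> i j ij; apply: (sorted_ltn_nth lt_trans) => //; rewrite ?inE //.
  by rewrite sort_lt_sorted undup_uniq.
- by [].
exists f => //; split.
  move=> p pP; have pxs : mid p \in xs by apply/xsP; exists p.
  have ip : (index (mid p) xs < size xs)%N by rewrite index_mem.
  exists (c (Ordinal ip)); first by apply: win => //; have := cx (Ordinal ip); rewrite /= nth_index.
  suff : Fix f (c (Ordinal ip)) by rewrite FixE => -[].
  by rewrite Fixf; right; exists (Ordinal ip).
move=> t t01 ft; have : Fix f t by rewrite FixE; split=> //; lra.
rewrite Fixf => -[[|]/=|[i _ cit]]; [lra|lra|].
have /xsP[p pP xp] := mem_nth 0 (ltn_ord i).
by exists p => //; apply: win => //; rewrite -cit -xp.
Qed.

(** A fixed point between two marks is a barrier for all powers. Barriers are put between any two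
    marks on the same side of [z, q] and nowhere in [z, q], so some power carries z beyond q. *)
Lemma push (M : seq R) z q : {in M, forall y, 0 < y < 1} -> z \in M -> q \in M ->
    z <= q ->
  exists2 f, Gamma f & [/\ q < ext f z,
    {in M &, forall m y, m < y -> m < ext f y} &
    {in M &, forall y m, y < m -> (q < m) || (m <= z) -> ext f y < m}].
Proof.
move=> M01 zM qM zq; have z01 := M01 z zM; have q01 := M01 q qM.
(* The extra endpoint 1 provides the window (q, 1), so [P] is not empty. *)
pose P := [seq p <- [seq (m, y) | m <- M, y <- 1 :: M]
              | (p.1 < p.2) && ((p.2 <= z) || (q <= p.1))].
have memP m y : m \in M -> y \in 1 :: M -> m < y -> (y <= z) || (q <= m) -> (m, y) \in P.
  by move=> mM yM my zqmy; rewrite mem_filter [_ < _]my [_ || _]zqmy; exact: allpairs_f.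
have [||g Gg [gfix gnofix]] := @fix_windows P.
- apply/eqP => P0; suff : (q, 1) \in P by rewrite P0.
  by apply: memP; rewrite ?mem_head ?lexx ?orbT //; case/andP: q01.
- move=> p; rewrite mem_filter => /andP[/andP[lt12 _] /allpairsPdep[m [y [mM + pE]]]].
  by have := M01 m mM; subst p; rewrite inE /= in lt12 * => ? /predU1P[|/M01]; split=> //; lra.
have {}gnofix t : z <= t <= q -> ext g t <> t.
  move=> ztq /gnofix[|p]; first by lra.
  by rewrite mem_filter => /andP[/andP[_ /orP[?|?]] _]; lra.
(* [g] cannot fix z; if it moves z down, its inverse moves z up and has the same fixed points. *)
have [h Gh [hfix hz hnofix]] : exists2 h, Gamma h &
    [/\ forall t, ext g t = t -> ext h t = t, z < ext h z &
      forall t, z <= t <= q -> ext h t <> t].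
  have [lt_gz|gt_gz|/esym e] := ltgtP z (ext g z).
  - by exists g.
  - exists g^-1%g; first exact: subgroupV.
    split=> [t gt||t /gnofix ngt gt].
    + by rewrite -[in LHS]gt extK.
    + by rewrite ltr_extV.
    + by apply: ngt; rewrite -[in LHS]gt extVK.
  - by case: (@gnofix z) => //; lra.
have [n hnz] := fixfree_orbit_gt hz hnofix.
exists (h ^+ n)%g; first exact: subgroupX.
have {}hfix p : p \in P -> exists2 t, p.1 < t < p.2 & ext (h ^+ n)%g t = t.
  move=> /gfix[t tp /hfix ht]; exists t => //.
  by elim: n {hnz} => [|n IHn]; rewrite ?ext1 // expgS extM IHn.
split=> // [m y mM yM my|y m yM mM ym /orP[qm|mz]].
(* If (m, y) is not a window, then z < y and m < q, and z already goes beyond q. *)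
- have [zqmy|] := boolP ((y <= z) || (q <= m)).
    have [|t /andP[/= mt ty] ht] := hfix (m, y); first by apply: memP; rewrite // inE yM orbT.
    by rewrite (lt_trans mt) // -[ltLHS]ht ext_lt.
  rewrite negb_or -!ltNge => /andP[zy mq].
  by rewrite (lt_trans mq) // (lt_trans hnz) // ext_lt.
(* The point y may lie below q; the window from max y q to m still bounds its image. *)
- have y'M : Num.max y q \in M by rewrite /Num.max; case: ifP.
  have [|t /andP[/= mt ty] ht] := hfix (Num.max y q, m).
    by apply: memP; rewrite ?inE ?mM ?orbT // ?le_max ?lexx ?orbT // gt_max ym.
  rewrite (lt_trans _ ty) // -[ltRHS]ht ext_lt.
  by apply: le_lt_trans mt; rewrite le_max lexx.
- have [|t /andP[/= mt ty] ht] := hfix (y, m).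
    by apply: memP; rewrite ?inE ?mM ?orbT ?mz.
  by rewrite (lt_trans _ ty) // -[ltRHS]ht ext_lt.
Qed.

(** Finitely many strict inequalities at finitely many points: a basic open set for pointwise
    convergence. *)
Definition constraints := (seq (R * R) * seq (R * R))%type.

Definition sat (D : constraints) (f : homeo R) : Prop :=
  {in D.1, forall p, ext f p.1 < p.2} /\ {in D.2, forall p, p.2 < ext f p.1}.

Definition coords (s : seq (R * R)) : seq R := map fst s ++ map snd s.

Definition points (D : constraints) : seq R := coords D.1 ++ coords D.2.

(** The first condition is forced by monotonicity, as p'.2 < f(p'.1) <= f(p.1) < p.2 for a solution
    f. *)
Definition consistent (D : constraints) : Prop :=
  {in D.1 & D.2, forall p p', p'.1 <= p.1 -> p'.2 < p.2} /\
  {in points D, forall x, 0 < x < 1}.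

Lemma mem_coords s p : p \in s -> (p.1 \in coords s) && (p.2 \in coords s).
Proof. by move=> ps; rewrite !mem_cat !map_f // orbT. Qed.

(* The lower constraints are fulfilled one by one by pushing points up. *)
Lemma lower_constraints U L f : Gamma f -> {in U, forall p, ext f p.1 < p.2} ->
  consistent (U, L) -> exists2 h, Gamma h & sat (U, L) h.
Proof.
move=> Gf fU; elim: L => [|[p q] L IHL] [cUL ULI]; first by exists f.
have [|h Gh [hU hL]] := IHL.
  split=> [p1 p2 p1U p2L|x xUL]; first by apply: cUL; rewrite // inE p2L orbT.
  apply: ULI; move: xUL; rewrite /points /coords !mem_cat !inE.
  by case/orP=> [->|/orP[]->]; rewrite ?orbT.
have [qhp|hpq] := ltP q (ext h p).
  by exists h => //; split=> // p'; rewrite inE => /predU1P[->|/hL].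
(* All current images and all bounds become marks, so that [push] controls every inequality already
   achieved. *)
pose s := (p, q) :: U ++ L; pose M := [seq ext h p.1 | p <- s] ++ [seq p.2 | p <- s].
have sI : {in s, forall p, 0 < p.1 < 1 /\ 0 < p.2 < 1}.
  move=> p' p's; suff : (p'.1 \in points (U, (p, q) :: L)) && (p'.2 \in points (U, (p, q) :: L)).
    by move=> /andP[? ?]; split; apply: ULI.
  rewrite /points ![_ \in coords _ ++ _]mem_cat.
  have : (p' \in U) || (p' \in (p, q) :: L).
    by move: p's; rewrite !(inE, mem_cat) => /or3P[]->; rewrite ?orbT.
  by case/orP=> /mem_coords/andP[-> ->]; rewrite ?orbT.
have M01 : {in M, forall y, 0 < y < 1}.
  by move=> y; rewrite mem_cat => /orP[]/mapP[p' /sI[? ?] ->]; rewrite ?ext_oo.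
have M1 p' : p' \in s -> ext h p'.1 \in M.
  by move=> ps; rewrite mem_cat (map_f (fun p => ext h p.1)).
have M2 p' : p' \in s -> p'.2 \in M by move=> ps; rewrite mem_cat (map_f snd) ?orbT.
have pqs : (p, q) \in s by rewrite mem_head.
have Us p' : p' \in U -> p' \in s by move=> pU; rewrite inE mem_cat pU orbT.
have Ls p' : p' \in L -> p' \in s by move=> pU; rewrite inE mem_cat pU !orbT.
have [g Gg [gz glow gup]] := push M01 (M1 _ pqs) (M2 _ pqs) hpq.
exists (g * h)%g; first exact: subgroupM.
split=> p' /=; last first.
  rewrite inE extM => /predU1P[->//|p'L].
  by apply: glow; [apply/M2/Ls|apply/M1/Ls|apply: hL].
move=> p'U; rewrite extM; have hp' := hU _ p'U.
(* [push] keeps points below a mark that is above q or at most z = h(p). If p <= p'.1, consistency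
   gives q < p'.2. Otherwise p'.2 <= h(p), or h(p) itself serves as a mark below p'.2. *)
have [pp'|p'p] := leP p p'.1.
  apply: gup => //; [exact/M1/Us|exact/M2/Us|].
  by rewrite (cUL p' (p, q)) ?mem_head.
have [p'2|p'2] := leP p'.2 (ext h p).
  by apply: gup => //; [exact/M1/Us|exact/M2/Us|rewrite p'2 orbT].
apply: lt_trans p'2; apply: gup => //; [exact/M1/Us|exact/(M1 (p, q))|by rewrite ext_lt|].
by rewrite lexx orbT.
Qed.

Definition swap (p : R * R) : R * R := (p.2, p.1).

(** Based on the equivalence of f(p) < q and p < f^-1(q): upper and lower constraints are
    exchanged. *)
Definition inv (D : constraints) : constraints :=
  (map swap D.2, map swap D.1).

Lemma sat_inv D f : sat (inv D) f <-> sat D f^-1%g.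
Proof.
split=> -[fU fL]; split=> p.
- by move=> pD; rewrite ltl_extV; apply: (fL (swap p)); apply: map_f.
- by move=> pD; rewrite ltr_extV; apply: (fU (swap p)); apply: map_f.
- by move=> /mapP[p' /fL + ->]; rewrite ltr_extV.
- by move=> /mapP[p' /fU + ->]; rewrite ltl_extV.
Qed.

Lemma points_inv D : points (inv D) =i points D.
Proof.
move=> x; rewrite /points /coords /inv !mem_cat -!map_comp.
by rewrite orbC; congr orb; rewrite orbC; congr orb; congr (_ \in _); apply: eq_map; case.
Qed.

Lemma consistent_inv D : consistent D -> consistent (inv D).
Proof.
move=> [cD DI]; split=> [p p' /mapP[a aD ->] /mapP[b bD ->] /=|x].
  by rewrite leNgt => /negP ba; rewrite ltNge; apply/negP => /(cD _ _ bD aD).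
by rewrite points_inv; exact: DI.
Qed.

(** Upper constraints are lower ones for the inverse. So [lower_constraints] is used twice: from the
    identity, to find an inverse of a solution of [U], then from that solution, to add [L]. *)
Lemma density D : consistent D -> exists2 f, Gamma f & sat D f.
Proof.
case: D => U L cUL.
have cU0 : consistent (U, [::]).
  split=> // x xU; apply: cUL.2; move: xU; rewrite /points /= !mem_cat orbF => /orP[]->;
  by rewrite ?orbT.
have [|||h Gh /(@sat_inv (U, [::]))[hU _]] := @lower_constraints [::] (map swap U) 1%g.
- exact: subgroup1.
- by [].
- exact: consistent_inv cU0.
- by apply: (@lower_constraints U L h^-1%g) => //; exact: subgroupV.
Qed.

End density.

(** * Following a point along words in two homeomorphisms yet to be chosen *)

Definition freely_reduced (T : eqType) (w : seq (T * bool)) : bool :=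
  sorted [rel a b : T * bool | ~~ ((a.1 == b.1) && (a.2 != b.2))] w.

Definition signed (G : groupType) (x : G) (e : bool) : G := if e then (x^-1)%g else x.

Lemma seq_max (R : realType) (x : R) s :
  exists2 m, m \in x :: s & {in x :: s, forall y, y <= m}.
Proof.
elim: s x => [|y s IHs] x.
  by exists x; rewrite ?mem_head // => z; rewrite inE => /eqP->.
have [m ms le_m] := IHs y; have [xm|mx] := leP x m.
  by exists m => [|z]; rewrite inE ?ms ?orbT // => /predU1P[->|/le_m].
exists x => [|z]; rewrite ?mem_head // inE => /predU1P[->//|/le_m zm].
exact: le_trans zm (ltW mx).
Qed.

Lemma seq_min (R : realType) (x : R) s :
  exists2 m, m \in x :: s & {in x :: s, forall y, m <= y}.
Proof.
have [m ms le_m] := seq_max (- x) (map -%R s).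
exists (- m) => [|y ys]; last by rewrite lerNl le_m // (map_f -%R (s := x :: s)).
by rewrite -(mem_map (@oppr_inj R)) opprK.
Qed.

Lemma avoid_finite (R : realType) (a b : R) (B : seq R) : a < b ->
  exists q : R * R, [/\ a < q.1, q.1 < q.2, q.2 < b &
    {in B, forall x, ~~ (q.1 <= x <= q.2)}].
Proof.
move=> ab; elim: B => [|x B [[q1 q2] /= [aq1 q12 q2b avB]]].
  by exists (a + (b - a) / 3, a + (b - a) / 3 * 2); split=> //=; lra.
pose m := (q1 + q2) / 2; have [xm|mx] := ltP x m.
  exists (m, q2); rewrite /m in xm *; split=> /= [|||y]; [lra..|].
  by rewrite inE => /predU1P[->|/avB]; lra.
(* Here x may equal m, so the left interval stops short of m. *)
exists (q1, (q1 + m) / 2); rewrite /m in mx *; split=> /= [|||y]; [lra..|].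
by rewrite inE => /predU1P[->|/avB]; lra.
Qed.

Section tracking.
Variable R : realType.
Implicit Types (D : constraints R) (f : bool -> homeo R) (l u : R).
Local Notation syllable := ((bool * bool) * homeo R)%type.

Definition sources D : seq R := map fst (D.1 ++ D.2).

Lemma sources_points D : {subset sources D <= points D}.
Proof.
by move=> x; rewrite /sources /points /coords map_cat !mem_cat => /orP[]->; rewrite ?orbT.
Qed.

(** Let a be the largest lower bound at sources up to u, and b the smallest upper bound at sources
    from l on. As no source lies in [l, u], consistency gives a < b, and the new bounds are chosen
    between a and b. *)
Lemma extend_constraints D l u (B : seq R) : consistent D ->
    0 < l -> l <= u -> u < 1 -> {in sources D, forall x, ~~ (l <= x <= u)} ->
  exists q : R * R, [/\ q.1 < q.2, consistent ((u, q.2) :: D.1, (l, q.1) :: D.2),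
    0 < q.1, q.2 < 1 & {in B, forall x, ~~ (q.1 <= x <= q.2)}].
Proof.
move=> [cD DI] l0 lu u1 fresh.
have DI1 p : p \in D.1 -> 0 < p.2 < 1.
  by move=> /mem_coords/andP[_ p2]; apply: DI; rewrite mem_cat p2.
have DI2 p : p \in D.2 -> 0 < p.2 < 1.
  by move=> /mem_coords/andP[_ p2]; apply: DI; rewrite mem_cat p2 orbT.
(* The defaults 0 and 1 keep the new bounds inside (0, 1). *)
have [a aD le_a] := seq_max 0 [seq p.2 | p <- D.2 & p.1 <= u].
have [b bD le_b] := seq_min 1 [seq p.2 | p <- D.1 & l <= p.1].
have ab : a < b.
  move: aD bD; rewrite !inE => /predU1P[->|/mapP[p + ->]].
    move=> /predU1P[->//|/mapP[p + ->]].
    by rewrite mem_filter => /andP[_ /DI1/andP[]].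
  rewrite mem_filter => /andP[pu pD] /predU1P[->|/mapP[p' + ->]].
    by case/andP: (DI2 _ pD).
  rewrite mem_filter => /andP[lp' p'D]; apply: cD => //.
  have := fresh p'.1; rewrite lp' /= -ltNge => up'.
  apply: le_trans pu (ltW (up' _)).
  by rewrite /sources map_cat mem_cat map_f.
have a0 := le_a _ (mem_head _ _); have b1 := le_b _ (mem_head _ _).
have [[q1 q2] /= [aq q12 qb avB]] := avoid_finite B ab.
exists (q1, q2); split=> //=; [|by lra..].
have le_a' p : p \in D.2 -> p.1 <= u -> p.2 <= a.
  by move=> pD pu; apply: le_a; rewrite inE map_f ?orbT // mem_filter pu.
have le_b' p : p \in D.1 -> l <= p.1 -> b <= p.2.
  by move=> pD pu; apply: le_b; rewrite inE map_f ?orbT // mem_filter pu.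
split=> [p p'|x] /=.
  rewrite !inE => /predU1P[->|pD] /predU1P[->|p'D] //=; last exact: cD.
  - by move=> /(le_a' _ p'D); lra.
  - by move=> /(le_b' _ pD); lra.
rewrite /points /coords /= !(inE, mem_cat) => xs.
have [xD|xD] := boolP (x \in points D); first exact: DI.
move: xD xs; rewrite /points /coords !mem_cat !negb_or => /andP[/andP[/negbTE-> /negbTE->]].
move=> /andP[/negbTE-> /negbTE->]; rewrite !(orbF, orFb).
by case/or4P=> /eqP->; lra.
Qed.

Definition orient D (e : bool) : constraints R := if e then inv D else D.

Lemma orientK e : cancel (orient^~ e) (orient^~ e).
Proof.
case: e => // -[U L]; rewrite /orient /inv /= -!map_comp.
by congr pair; rewrite map_id_in // => -[].
Qed.

Lemma sat_orient D e (h : homeo R) : sat (orient D e) (signed h e) <-> sat D h.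
Proof. by case: e => //=; rewrite /orient sat_inv invgK. Qed.

Lemma points_orient D e : points (orient D e) =i points D.
Proof. by case: e => //; exact: points_inv. Qed.

Lemma consistent_orient D e : consistent D -> consistent (orient D e).
Proof. by case: e => //; exact: consistent_inv. Qed.

Definition syllables_value f (w : seq syllable) : homeo R :=
  (\prod_(x <- w) (x.2 * signed (f x.1.1) x.1.2))%g.

(* Each new constraint sends the current interval into a gap that is not yet
   used.  The word in the [f k] stays reduced when the homeomorphisms [x.2] are
   deleted, so the next letter is never constrained near the current interval,
   even when [x.2] fixes it. *)
Lemma track (D : bool -> constraints R) x0 (w : seq syllable) :
    (forall k, consistent (D k)) -> 0 < x0 < 1 ->
    (forall k, x0 \notin points (D k)) -> freely_reduced (map fst w) ->
  exists (D' : bool -> constraints R) l u, [/\ forall k, consistent (D' k),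
    forall f, (forall k, sat (D' k) (f k)) ->
      (forall k, sat (D k) (f k)) /\ l <= ext (syllables_value f w) x0 <= u,
    [/\ 0 < l, l <= u & u < 1],
    forall k e, ohead (map fst w) != Some (k, ~~ e) ->
      {in sources (orient (D' k) e), forall x, ~~ (l <= x <= u)} &
    w != [::] -> ~~ (l <= x0 <= u)].
Proof.
move=> cD x01 x0D; elim: w => [|[[k e] g] w IHw] redw.
  exists D, x0, x0; split=> //; [|by split; case/andP: x01|].
    by move=> f fD; rewrite /syllables_value big_nil ext1 lexx.
  move=> k e _ x /sources_points; rewrite points_orient => xD.
  rewrite -eq_le; apply: contra (x0D k) => /eqP xx0.
  by rewrite xx0.
have [|D' [l [u [cD' D'f [l0 lu u1] fresh _]]]] := IHw; first exact: path_sorted redw.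
pose E := orient (D' k) e.
(* The image interval must miss x0 and all possible sources for the next letter, including the l and
   u about to be added. It is chosen before [g] acts, so [B] is pulled back by [g]. *)
pose B := x0 :: l :: u :: points (D' true) ++ points (D' false).
have ptB k' : {subset points (D' k') <= B}.
  by move=> x xD; case: k' xD => xD; rewrite !inE mem_cat xD !orbT.
have cE : consistent E by exact: consistent_orient.
have [|[q1 q2] /= [q12 cE' q10 q21 avB]] :=
    extend_constraints (map (ext g^-1%g) B) cE l0 lu u1.
  apply: fresh; case: w redw {IHw D'f} => //= -[[k' e'] g'] w /andP[+ _].
  by apply: contraNneq => -[-> ->]; rewrite eqxx /=; case: (e).
have {}avB x : x \in B -> ~~ (ext g q1 <= x <= ext g q2).
  move=> xB; have := avB _ (map_f _ xB).
  by rewrite -(ext_le g) -(ext_le g _ q2) extVK.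
pose E' : constraints R := ((u, q2) :: E.1, (l, q1) :: E.2).
exists (fun k' => if k' == k then orient E' e else D' k'), (ext g q1), (ext g q2).
split=> [k'|f satf||k' e'|_].
- by case: eqP => // _; exact: consistent_orient.
- have := satf k; rewrite eqxx -(sat_orient _ e) orientK => -[/= sU sL].
  have [|sDf /andP[lw wu]] := D'f f.
    move=> k'; have := satf k'; case: eqP => // -> _.
    apply/(sat_orient _ e); split=> p pE; [apply: sU|apply: sL];
    by rewrite inE pE orbT.
  split=> //; rewrite /syllables_value big_cons /= !extM !ext_le.
  have /= lq1 := sL _ (mem_head _ _); have /= uq2 := sU _ (mem_head _ _).
  rewrite (le_trans (ltW lq1)) ?ext_le //=.
  by rewrite (le_trans _ (ltW uq2)) ?ext_le.
- have := ext_oo g q1; have := ext_oo g q2.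
  rewrite q10 q21 (lt_trans q10 q12) (lt_trans q12 q21) ext_le (ltW q12).
  by move=> /andP[_ ->] /andP[->].
- move=> kk' x; case: eqP => [k'k|_] xD; last first.
    by apply: avB; apply: (ptB k'); rewrite -(points_orient _ e'); exact: sources_points.
  (* The next letter does not cancel the one just used, so the signs agree and the new sources are l
     and u, not q1 and q2. *)
  have {}e'e : e' = e.
    by apply: contraNeq kk'; rewrite k'k /=; case: (e) (e') => [] [].
  move: xD; rewrite e'e orientK /E' /sources /= inE map_cat /= mem_cat inE => xs.
  apply: avB; have [->|xu] := eqVneq x u; first by rewrite !inE eqxx !orbT.
  have [->|xl] := eqVneq x l; first by rewrite !inE eqxx !orbT.
  apply: (ptB k); rewrite -(points_orient _ e); apply: sources_points.
  by move: xs; rewrite (negbTE xu) (negbTE xl) /= /sources map_cat mem_cat.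
- by apply: avB; rewrite mem_head.
Qed.

(** Words are treated one at a time, each from a point off all earlier constraints. [track] only
    strengthens the constraints, so words already handled stay nontrivial. *)
Lemma nontrivial_constraints (ws : seq (seq syllable)) :
    {in ws, forall w, freely_reduced (map fst w) /\ w != [::]} ->
  exists2 D : bool -> constraints R, forall k, consistent (D k) &
    forall f, (forall k, sat (D k) (f k)) ->
      {in ws, forall w, syllables_value f w <> 1%g}.
Proof.
elim: ws => [|w ws IHws] redws; first by exists (fun=> ([::], [::])).
have [|D cD Df] := IHws; first by move=> v vws; apply: redws; rewrite inE vws orbT.
have [[x0 x1] /= [x00 x01 x11 x0D]] :=
  avoid_finite (points (D true) ++ points (D false)) (@ltr01 R).
have [redw w0] := redws _ (mem_head _ _).
have [||k|//|D' [l [u [cD' D'f _ _ x0lu]]]] := @track D x0 w => //.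
- lra.
- apply/negP => x0k; suff /x0D : x0 \in points (D true) ++ points (D false).
    by rewrite lexx (ltW x01).
  by rewrite mem_cat; case: k x0k => ->; rewrite ?orbT.
- exists D' => // f /D'f[fD lwu] v; rewrite inE => /predU1P[->|/Df]; last exact.
  by move=> w1; move: lwu (x0lu w0); rewrite w1 ext1 => ->.
Qed.

End tracking.

(** * Integer powers in a group *)

Section integer_powers.
Variable G : groupType.
Implicit Type x : G.

Definition zpow x (k : int) : G :=
  match k with Posz n => (x ^+ n)%g | Negz n => (x ^- n.+1)%g end.

Lemma zpow1D x k : zpow x (1 + k) = (x * zpow x k)%g.
Proof.
case: k => [n|[|n]]; first by rewrite -PoszD /= add1n expgS.
  by rewrite /= expg0 expg1 mulgV.
rewrite (_ : 1 + Negz n.+1 = Negz n) /=; last by rewrite !NegzE; lia.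
by rewrite [in RHS]expgSr invgM mulVKg.
Qed.

Lemma zpowN1D x k : zpow x (-1 + k) = (x^-1 * zpow x k)%g.
Proof. by rewrite -[in RHS](subrKC 1 k) addrC zpow1D mulKg addrC. Qed.

Lemma zpow_signed x (e : bool) n k :
  zpow x ((-1) ^+ e * n%:Z + k) = (signed (x ^+ n) e * zpow x k)%g.
Proof.
elim: n k => [|n IHn] k; first by rewrite mulr0 add0r; case: e; rewrite /= expg0 ?invg1 mul1g.
have -> : (-1) ^+ e * n.+1%:Z + k = (-1) ^+ e * n%:Z + ((-1) ^+ e + k).
  by rewrite -addn1 PoszD mulrDr mulr1 addrA.
rewrite IHn; case: e {IHn}; rewrite /= ?expr1 ?expr0 ?zpowN1D ?zpow1D mulgA //.
  by rewrite expgS invgM.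
by rewrite expgSr.
Qed.

End integer_powers.

(** * Expanding words in the new generators *)

Section words.
Variables (R : realType) (n m : nat) (g : 'I_n -> homeo R).
Local Notation syllable := ((bool * bool) * homeo R)%type.
Local Notation letter := (bool + 'I_n)%type.
Implicit Types (f : bool -> homeo R) (w : seq (letter * bool)).

(** These exponents exceed m and differ pairwise by more than m. *)
Definition padding (i : nat) : nat := (m.+1 * i.+1)%N.

(** By the symmetric form a^N b g b a^N, inversion only reverses all signs. *)
Definition generator f (x : letter) : homeo R :=
  match x with
  | inl k => f k
  | inr i => (f false ^+ padding i * (f true * (g i * f true)) * f false ^+ padding i)%g
  end.

Definition power_syllables (k : int) : seq syllable :=
  nseq `|k| ((false, k < 0), 1%g).

(* [(k, s)] stands for the reduced word a^k s, with s empty or starting with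
   b or b^-1, where a = [f false] and b = [f true]. *)
Fixpoint normal_form w : int * seq syllable :=
  if w is (x, e) :: w' then
    let: (k, s) := normal_form w' in
    match x with
    | inl false => ((-1) ^+ e + k, s)
    | inl true => (0, ((true, e), 1%g) :: power_syllables k ++ s)
    | inr i => let p := (-1) ^+ e * (padding i)%:Z in
      (p, [:: ((true, e), 1%g), ((true, e), signed (g i) e)
            & power_syllables (p + k) ++ s])
    end
  else (0, [::]).

Definition syllables w : seq syllable :=
  power_syllables (normal_form w).1 ++ (normal_form w).2.

Lemma power_syllables_value f k :
  syllables_value f (power_syllables k) = zpow (f false) k.
Proof.
rewrite /syllables_value big_nseq; case: k => j /=; rewrite mul1g.
  by elim: j => //= j ->; rewrite expgS.
rewrite -expVgn; elim: j => [|j IHj] /=; first by rewrite expg1 mulg1.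
by rewrite IHj [in RHS]expgS.
Qed.

Lemma syllables_value_cat f s1 s2 :
  syllables_value f (s1 ++ s2) = (syllables_value f s1 * syllables_value f s2)%g.
Proof. by rewrite /syllables_value big_cat. Qed.

Lemma syllables_value_cons f x s : syllables_value f (x :: s) =
  (x.2 * signed (f x.1.1) x.1.2 * syllables_value f s)%g.
Proof. by rewrite /syllables_value big_cons. Qed.

Lemma syllablesP f w : syllables_value f (syllables w) =
  (\prod_(x <- w) signed (generator f x.1) x.2)%g.
Proof.
elim: w => [|[x e] w IHw]; first by rewrite /syllables_value !big_nil.
rewrite big_cons -{}IHw /syllables /=; case: (normal_form w) => k s /=.
case: x => [[]|i]; rewrite !syllables_value_cat !power_syllables_value.
- by rewrite syllables_value_cons syllables_value_cat power_syllables_value /= expg0 !mul1g.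
- have := zpow_signed (f false) e 1 k; rewrite mulr1 => -> /=.
  by rewrite expg1 mulgA.
- rewrite !syllables_value_cons syllables_value_cat power_syllables_value.
  rewrite zpow_signed -[in zpow _ (_ * _)](addr0 (_ * _)) zpow_signed /= expg0 mulg1 mul1g.
  by case: e; rewrite /= ?invgM ?mulgA.
Qed.

Definition first_letter (s : seq syllable) : option (bool * bool) := ohead (map fst s).

(* When [normal_form w = (k, s)] and [w] is a^t w'' with w'' not starting with
   a or a^-1, [B] is the first letter of w''. *)
Definition shape w (k : int) (s : seq syllable) (t : int) (B : option (letter * bool)) : Prop :=
  [/\ k = t + (if B is Some (inr i, e) then (-1) ^+ e * (padding i)%:Z else 0),
      first_letter s = omap (fun y => (true, y.2)) B,
      `|t| <= (size w)%:Z,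
      t = 0 -> ohead w = B &
      if ohead w is Some (inl false, e) then 0 < (-1) ^+ e * t else t = 0].

Lemma path_power_syllables e k s : freely_reduced (map fst s) ->
    (forall e', first_letter s != Some (false, e')) ->
    (k = 0 -> first_letter s != Some (true, ~~ e)) ->
  freely_reduced ((true, e) :: map fst (power_syllables k ++ s)).
Proof.
move=> reds sF; rewrite /power_syllables /freely_reduced /= map_cat map_nseq /=.
have pathF c d : path [rel a b : bool * bool | ~~ ((a.1 == b.1) && (a.2 != b.2))]
    (false, d) (nseq c (false, d) ++ map fst s).
  elim: c => [|c IHc] /=; last by rewrite eqxx.
  by case: s reds sF => //= -[[[] e'] h] s /= -> // /(_ e'); rewrite eqxx.
case: (absz k) (absz_eq0 k) => [|c] /= k0 kT; last exact: pathF.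
have {kT pathF} := kT (eqP (esym k0)).
case: s reds sF => //= -[[[] e'] h] s /= -> // _; rewrite /first_letter /=.
by case: e e' => [] [].
Qed.

Lemma reduced_power_syllables k s : freely_reduced (map fst s) ->
    (forall e', first_letter s != Some (false, e')) ->
  freely_reduced (map fst (power_syllables k ++ s)).
Proof.
move=> reds sF.
have [->|k0] := eqVneq k 0; first by [].
have := @path_power_syllables true k s reds sF; rewrite {1}/freely_reduced /=.
by move=> /(_ _)/path_sorted; apply => k0'; rewrite k0' eqxx in k0.
Qed.

(** Two letters b^e and b^-e can cancel only if the power of a between them is trivial. Its exponent
    is t, with |t| <= m, plus paddings of the neighbouring h-letters. If it vanishes, so does t, and
    any paddings come from the same i with opposite signs; then w has adjacent inverse letters. *)
Lemma normal_formP w : (size w <= m)%N -> freely_reduced w ->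
  let: (k, s) := normal_form w in
  freely_reduced (map fst s) /\ exists t B, shape w k s t B.
Proof.
elim: w => [|[x e] w IHw] /=; first by move=> _ _; split=> //; exists 0, None.
move=> szw redw; have := IHw (ltnW szw) (path_sorted redw).
case: (normal_form w) => k s [reds [t [B [kE sB tw t0 tsign]]]].
have redh y : ohead w = Some y -> y.1 = x -> y.2 = e.
  case: w redw {IHw szw t0 tw tsign} => //= y' w /andP[+ _] [<-] y'x.
  by rewrite y'x eqxx negbK /= => /eqP.
have sF e' : first_letter s != Some (false, e').
  by rewrite sB; case: B {sB kE t0} => [[? ?]|].
have padm i : (m < padding i)%N by rewrite /padding mulnS; lia.
have tm : `|t| <= m%:Z by apply: le_trans tw _; rewrite lez_nat ltnW.
have signM (b : bool) : (-1) ^+ b * (-1) ^+ b = 1 :> int by case: b.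
case: x redw redh => [[]|i] redw redh.
- split; last by exists 0, (Some (inl true, e)).
  apply: path_power_syllables => // k0; rewrite sB; apply/eqP.
  case: B sB kE t0 => // -[y e'] _ kE t0 [e'e].
  case: y kE t0 => [b|i] kE t0.
    have t00 : t = 0 by rewrite kE addr0 in k0.
    case: b {kE} t0 => /(_ t00) hw; last by move: tsign; rewrite hw t00 mulr0 ltxx.
    by have := redh _ hw erefl; rewrite /= e'e; case: (e).
  by have := padm i; move: k0; rewrite kE; case: (e'); rewrite /= ?expr0 ?expr1; lia.
(* Adjacent letters a have equal signs, so t moves away from 0. *)
- have t'_gt0 : 0 < (-1) ^+ e * ((-1) ^+ e + t).
    rewrite mulrDr signM; move: tsign redh; case: (ohead w) => [[[[]|i] e']|] => [->|h|->|->].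
    + by rewrite mulr0.
    + by move=> /(_ _ erefl erefl) /= <-; lia.
    + by rewrite mulr0.
    + by rewrite mulr0.
  split=> //; exists ((-1) ^+ e + t), B; split=> //.
  + by rewrite kE addrA.
  + by move: tw; case: (e); rewrite /= ?expr0 ?expr1; lia.
  + by move=> t'0; rewrite t'0 mulr0 ltxx in t'_gt0.
- split; last by exists 0, (Some (inr i, e)); split; rewrite ?add0r.
  rewrite /= /freely_reduced /= !eqxx /=.
  apply: path_power_syllables => // k0; rewrite sB; apply/eqP.
  case: B sB kE t0 => // -[y e'] _ kE t0 [e'e].
  case: y kE t0 => [b|j] kE t0.
    have := padm i; move: k0; rewrite kE; case: (e); rewrite /= ?expr0 ?expr1; lia.
  have [ij|ij] := eqVneq i j.
    have t00 : t = 0.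
      by move: k0; rewrite kE ij e'e; case: (e); rewrite /= ?expr0 ?expr1; lia.
    by have := redh _ (t0 t00); rewrite /= ij e'e => /(_ erefl); case: (e).
  have : (padding i + m.+1 <= padding j)%N \/ (padding j + m.+1 <= padding i)%N.
    rewrite /padding -!mulnSr !leq_pmul2l //.
    by case: (ltngtP i j) => [||/val_inj/eqP]; [left|right|rewrite (negbTE ij)].
  by move: k0; rewrite kE e'e; case: (e); rewrite /= ?expr0 ?expr1; lia.
Qed.

Lemma syllables_reduced w : (size w <= m)%N -> freely_reduced w -> w != [::] ->
  freely_reduced (map fst (syllables w)) /\ syllables w != [::].
Proof.
move=> szw redw w0; have := normal_formP szw redw; rewrite /syllables.
case: (normal_form w) => k s [reds [t [B [kE sB _ t0 _]]]]; split.
  apply: reduced_power_syllables => // e'.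
  by rewrite sB; case: B {sB kE t0} => [[? ?]|].
(* If nothing is left, s is empty, so [B] is [None], and k = t = 0; then w has no first letter. *)
apply: contraNneq w0; rewrite /power_syllables /=.
case: s {reds} sB => [|y s]; last by case: (`|k|%N).
case: B kE t0 => // kE t0 _; case: (absz k) (absz_eq0 k) => // /esym/eqP k0 _.
by rewrite k0 addr0 in kE; case: w {szw redw} t0 => // y w /(_ (esym kE)).
Qed.

End words.

(** * Generating sets of large girth *)

(** [generator] need not be injective. Choosing one letter for each element still lifts reduced
    words to reduced words, since equal letters come from equal elements. *)
Lemma relation_size_gt (R : realType) (n m : nat) (g : 'I_n -> homeo R) (f : bool -> homeo R) :
    {in [seq syllables m g (val w) | w <- enum {: m.-bseq ((bool + 'I_n) * bool)}
           & freely_reduced (val w) && (val w != [::])],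
      forall s, syllables_value f s <> 1%g} ->
  forall w, relation_among (range (generator m g f)) w -> (m < size w)%N.
Proof.
move=> nontriv w [wS redw w0 w1]; rewrite ltnNge; apply/negP => szw.
pose lift (h : homeo R) := odflt (inl true) [pick x | generator m g f x == h].
pose v := [seq (lift a.1, a.2) | a <- w].
have liftK a : a \in w -> generator m g f (lift a.1) = a.1.
  move=> /wS[x _ xa]; rewrite /lift; case: pickP => [y /eqP//|/(_ x)].
  by rewrite xa eqxx.
have redv : freely_reduced v.
  rewrite /freely_reduced /v sorted_map.
  apply: (@sub_in_sorted _ (mem w)) redw; last exact/allP.
  move=> a b aw bw /=; apply: contra => /andP[/eqP ab ->]; rewrite andbT.
  by rewrite -(liftK _ aw) -(liftK _ bw) ab.
have szv : (size v <= m)%N by rewrite size_map.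
apply: (nontriv (syllables m g v)).
  apply/mapP; exists (Bseq szv) => //.
  by rewrite mem_filter mem_enum redv !andbT -size_eq0 size_map size_eq0.
rewrite syllablesP -[RHS]w1 /word_value big_map.
by apply: eq_big_seq => a aw /=; rewrite liftK.
Qed.

Lemma generating_set_range (R : realType) (Gamma : set (homeo R)) (m : nat)
    (s : seq (homeo R)) (f : bool -> homeo R) :
    is_subgroup Gamma -> smallest (is_subgroup (G := homeo R)) [set` s] = Gamma ->
    (forall k, Gamma (f k)) ->
  finite_generating_set Gamma (range (generator m (tnth (in_tuple s)) f)).
Proof.
move=> GammaG sGamma fG; set g := tnth _.
have gG i : Gamma (g i).
  by rewrite -sGamma; apply: sub_gen_smallest; exact: (mem_tnth i (in_tuple s)).
split; first by apply: finite_image; exact: finite_finset.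
apply/seteqP; split.
  apply: smallest_sub => // _ [[k|i] _ <-] /=; first exact: fG.
  by do ?apply: subgroupM => //; apply: subgroupX.
rewrite -sGamma => h0 h0S H [HG genH]; apply: h0S; split=> // h hs.
have /tnthP[i ->] : h \in in_tuple s by [].
have fH k : H (f k) by apply: genH; exists (inl k).
have hiH : H (generator m g f (inr i)) by apply: genH; exists (inr i).
pose p := (f false ^+ padding m i)%g.
(* Solving h_i = p b g_i b p for g_i. *)
have -> : tnth (in_tuple s) i =
    ((f true)^-1 * (p^-1 * (generator m g f (inr i) / p)) / f true)%g.
  by rewrite /generator -/p mulgK !mulKg mulgK.
have pH : H p by exact: subgroupX.
by do ?[apply: subgroupM => //]; exact: subgroupV.
Qed.

Theorem theorem1p5 (R : realType) (Gamma : set (homeo R))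
  (Gamma_subgroup : is_subgroup Gamma)
  (Gamma_fg : finitely_generated Gamma)
  (Gamma_fix : forall (N : nat) (x : 'I_N -> R) (eps : R),
     (0 < N)%N ->
     (forall i : 'I_N, 0 < x i < 1) ->
     (forall i j : 'I_N, (i < j)%N -> x i < x j) ->
     0 < eps ->
     exists2 gamma : homeo R, Gamma gamma &
       exists2 c : 'I_N -> R,
         Fix gamma = [set 0; 1] `|` range c &
         forall i : 'I_N, `|c i - x i| < eps) :
  girth R Gamma = +oo%E.
Proof.
case: Gamma_fg => S [/finite_seqP[s ->] sGamma].
(* For each real A > 0 a generating set without relations of length at most m is built, where m >
   A. *)
apply/eqyP => A A0; pose m := Num.bound A.
pose g := tnth (in_tuple s).
(* Only finitely many words have length at most m, so finitely many constraints handle them all. *)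
pose words := [seq syllables m g (val w) | w <- enum {: m.-bseq ((bool + 'I_(size s)) * bool)}
                 & freely_reduced (val w) && (val w != [::])].
have [|D cD nontriv] := @nontrivial_constraints R words.
  move=> _ /mapP[w + ->]; rewrite mem_filter => /andP[/andP[redw w0] _].
  exact: syllables_reduced (size_bseq w) redw w0.
have /choice[f fD] : forall k, exists h, Gamma h /\ sat (D k) h.
  by move=> k; have [h ? ?] := density Gamma_subgroup Gamma_fix (cD k); exists h.
apply: (@le_trans _ _ (m%:R)%:E); first by rewrite lee_fin ltW // archi_boundP // ltW.
apply: (@le_trans _ _ (girth_wrt R (range (generator m g f)))); last first.
  apply: ereal_sup_ubound; exists (range (generator m g f)) => //.
  by apply: generating_set_range => // k; case: (fD k).
apply: le_ereal_inf_tmp => _ [w relw <-].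
rewrite lee_fin ler_nat ltnW //; apply: relation_size_gt relw.
by apply: nontriv => k; case: (fD k).
Qed.
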